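(* Assume that the bounded bilinear form $b:Y\times V\to\mathbb{R}$ satisfies the following: there is a constant $C_b>0$ with $$C_b\|y\|_Y\le \sup_{0\ne v\in V}\frac{b(y,v)}{\|v\|_V}\quad\forall y\in Y,\qquad\text{and}\qquad \{v\in V: b(y,v)=0\ \text{for all } y\in Y\}=\{0\}.$$ Assume also that $\Pi:V\to V_h$ is a Fortin operator. Let $(\bar{\mathsf y},\bar{\mathsf u})\in Y\times U_{ad}$ be the unique solution of the continuous optimal control problem and $(\bar{\mathsf y}_h,\bar{\mathsf u}_h)\in Y_h\times U_{ad,h}$ the unique solution of the discrete optimal control problem, and let $(\bar\lambda,\bar{\mathsf p})\in Y\times V$ and $(\bar\lambda_h,\bar{\mathsf p}_h)\in Y_h\times V_h$ be the corresponding optimal adjoint state and discrete optimal adjoint state (all defined in the context). Let $\tilde{\mathsf u}\in U_{ad}$ (assumed to exist and to be computable) satisfy $$(\mathcal I_{U'}^{U}D^*\bar{\mathsf p}_h+\alpha\tilde{\mathsf u},\mathsf u-\tilde{\mathsf u})_U\ge0\qquad\forall\mathsf u\in U_{ad}.$$ Then $$\alpha^2\|\bar{\mathsf u}-\bar{\mathsf u}_h\|_U^2\lesssim(1+\alpha^2)\|\tilde{\mathsf u}-\bar{\mathsf u}_h\|_U^2+\|D\bar{\mathsf u}_h-B\bar{\mathsf y}_h\|_{V'}^2+\|O^*\mathcal I_{\mathcal Y}^{\mathcal Y'}(O\bar{\mathsf y}_h-\mathsf y_d)-B^*\bar{\mathsf p}_h\|_{Y'}^2,$$ $$\|\bar{\mathsf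 y}-\bar{\mathsf y}_h\|_Y^2\lesssim\|D\bar{\mathsf u}_h-B\bar{\mathsf y}_h\|_{V'}^2+\|\bar{\mathsf u}-\bar{\mathsf u}_h\|_U^2,$$ and $$\|\bar{\mathsf p}-\bar{\mathsf p}_h\|_V^2\lesssim\|D\bar{\mathsf u}_h-B\bar{\mathsf y}_h\|_{V'}^2+\|O^*\mathcal I_{\mathcal Y}^{\mathcal Y'}(O\bar{\mathsf y}_h-\mathsf y_d)-B^*\bar{\mathsf p}_h\|_{Y'}^2+\|\bar{\mathsf u}-\bar{\mathsf u}_h\|_U^2 .$$
   Context: $U,Y,V,\mathcal Y$ are real Hilbert spaces; $U_{ad}\subseteq U$ is non-empty, bounded, closed and convex; $b:Y\times V\to\mathbb{R}$ is a bounded bilinear form and $B:Y\to V'$ is given by $\langle By,v\rangle_{V',V}=b(y,v)$; $O:Y\to\mathcal Y$ and $D:U\to V'$ are bounded linear operators; $\mathsf y_d\in\mathcal Y$ and $\alpha>0$ are given. The cost functional is $J(\mathsf y,\mathsf u):=\tfrac12\|O\mathsf y-\mathsf y_d\|_{\mathcal Y}^2+\tfrac{\alpha}{2}\|\mathsf u\|_U^2$. For a bounded linear operator $T$, $T^*$ is its dual; biduals are identified with the original Hilbert spaces, so $B^*:V\to Y'$ and $D^*:V\to U'$. $\mathcal I_{X}^{X'}:X\to X'$ is the canonical (Riesz) isomorphism, and $\mathcal I_{X'}^{X}$ is its inverse. Continuous problem: minimize $J(\mathsf y,\mathsf u)$ over $(\mathsf y,\mathsf u)\in Y\times U_{ad}$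 subject to $b(\mathsf y,v)=\langle D\mathsf u,v\rangle_{V',V}$ for all $v\in V$. The optimal adjoint state $(\bar\lambda,\bar{\mathsf p})\in Y\times V$ is the unique solution of $$(\bar{\mathsf p},v)_V-b(\bar\lambda,v)=0,\quad b(w,\bar{\mathsf p})=\langle O^*\mathcal I_{\mathcal Y}^{\mathcal Y'}(O\bar{\mathsf y}-\mathsf y_d),w\rangle_{Y',Y}\quad\forall(v,w)\in V\times Y.$$ Discretization: $V_h\subseteq V$ and $Y_h\subseteq Y$ are finite-dimensional subspaces, and $U_h\subseteq U$ is a (not necessarily discrete) subspace with $U_{ad,h}:=U_h\cap U_{ad}\neq\emptyset$; the choice $U_h=U$ is allowed. The operator $\Theta_h:Y\to V_h$ is defined by $(\Theta_h\mathsf y,v_h)_V=b(\mathsf y,v_h)$ for all $v_h\in V_h$, and $V_h^{\Theta_h}:=\Theta_h(Y_h)$. A map $\Pi:V\to V_h$ is a Fortin operator if there is $C_\Pi>0$ such that $\|\Pi v\|_V\le C_\Pi\|v\|_V$ and $b(\mathsf y_h,v-\Pi v)=0$ for all $\mathsf y_h\in Y_h$, $v\in V$. Discrete problem: minimize $J(\mathsf y_h,\mathsf u_h)$ over $(\mathsf y_h,\mathsf u_h)\in Y_h\times U_{ad,h}$ subject to $b(\mathsf y_h,v_h)=\langle D\mathsf u_h,v_h\rangle_{V',V}$ for all $v_h\in V_h^{\Theta_h}$. The discrete optimal adjoint state $(\bar\lambda_h,\bar{\mathsf p}_h)\in Y_h\times V_h$ is the unique solution of $$(\bar{\mathsf p}_h,v_h)_V-b(\bar\lambda_h,v_h)=0,\quad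 b(w_h,\bar{\mathsf p}_h)=\langle O^*\mathcal I_{\mathcal Y}^{\mathcal Y'}(O\bar{\mathsf y}_h-\mathsf y_d),w_h\rangle_{Y',Y}\quad\forall(v_h,w_h)\in V_h\times Y_h.$$ Notation: $A\lesssim R$ is the usual shorthand for $A\le C\,R$ with a generic constant $C>0$. *)

(* Defs.v *)
From HB Require Import structures.
From mathcomp Require Import all_boot all_order all_algebra.
From mathcomp Require Import all_classical all_reals.
From mathcomp Require Import topology normedtype convex.
From mathcomp Require Import ring lra.

Set Implicit Arguments.
Unset Strict Implicit.
Unset Printing Implicit Defensive.

Import Order.TTheory GRing.Theory Num.Theory.
Import numFieldNormedType.Exports.

Local Open Scope classical_set_scope.
Local Open Scope ring_scope.

HB.mixin Record CompleteNormedModule_isHilbert (R : realType) (X : Type)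
    of CompleteNormedModule R X := {
  dotp : {dot X for @idfun R} ;
  dotp_normE : forall x : X, dotp x x = `|x| ^+ 2
}.

#[short(type="hilbertType")]
HB.structure Definition Hilbert (R : realType) :=
  {X of CompleteNormedModule R X & CompleteNormedModule_isHilbert R X}.

Section hilbert_theory.
Context {R : realType} {X : hilbertType R}.
Implicit Types (x y z : X) (a : R).

Lemma dotpC x y : dotp x y = dotp y x.
Proof. by rewrite (hermC dotp) /= expr0 mul1r. Qed.

Lemma dotpDr x y z : dotp x (y + z) = dotp x y + dotp x z.
Proof. exact: (linearDr dotp). Qed.

Lemma dotpZr a x y : dotp x (a *: y) = a * dotp x y.
Proof. exact: (linearZr_LR dotp). Qed.

Lemma dotpDl x y z : dotp (y + z) x = dotp y x + dotp z x.
Proof. by rewrite dotpC dotpDr !(dotpC x). Qed.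

Lemma dotpZl a x y : dotp (a *: y) x = a * dotp y x.
Proof. by rewrite dotpC dotpZr (dotpC x). Qed.

Lemma dotpNr x y : dotp x (- y) = - dotp x y.
Proof. by rewrite -scaleN1r dotpZr mulN1r. Qed.

Lemma dotpNl x y : dotp (- y) x = - dotp y x.
Proof. by rewrite dotpC dotpNr dotpC. Qed.

Lemma normDsq x y : `|x + y| ^+ 2 = `|x| ^+ 2 + 2 * dotp x y + `|y| ^+ 2.
Proof. by rewrite -!dotp_normE dotpDr !dotpDl (dotpC y x); lra. Qed.

Lemma normBsq x y : `|x - y| ^+ 2 = `|x| ^+ 2 - 2 * dotp x y + `|y| ^+ 2.
Proof. by rewrite normDsq dotpNr normrN; lra. Qed.

Lemma dotp_ler x y : dotp x y <= `|x| * `|y|.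
Proof.
have [->|x0] := eqVneq x 0.
  by rewrite -(scale0r 0) dotpZl mul0r mulr_ge0.
have [->|y0] := eqVneq y 0.
  by rewrite -(scale0r 0) dotpZr mul0r mulr_ge0.
have nx : 0 < `|x| by rewrite normr_gt0.
have ny : 0 < `|y| by rewrite normr_gt0.
have := sqr_ge0 `| `|y| *: x + (- `|x|) *: y|.
rewrite -dotp_normE dotpDr !dotpDl !dotpZr !dotpZl !dotp_normE (dotpC y x).
set d := dotp x y => h.
have nxy : 0 < `|x| * `|y| by exact: mulr_gt0.
rewrite -(ler_pM2l nxy).
move: h nx ny nxy; nra.
Qed.

Lemma CauchySchwarz_dotp x y : `|dotp x y| <= `|x| * `|y|.
Proof.
rewrite ler_norml dotp_ler andbT lerNl.
by rewrite -mulN1r -dotpZr (le_trans (dotp_ler _ _))// normrZ normrN1 mul1r.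
Qed.

End hilbert_theory.

Section bounded_linear_operators.
Context {R : realType}.

Definition bounded_linear (X Z : normedModType R) : {pred X -> Z} :=
  [pred T : X -> Z |
    `[< linear T /\ exists M : R, forall x, `|T x| <= M * `|x| >]].

Record blin (X Z : normedModType R) := Blin {
  blin_fun :> X -> Z ;
  blin_funP : blin_fun \in @bounded_linear X Z
}.

HB.instance Definition _ (X Z : normedModType R) :=
  [isSub of blin X Z for @blin_fun X Z].
HB.instance Definition _ (X Z : normedModType R) := [Choice of blin X Z by <:].

Lemma blinP (X Z : normedModType R) (T S : blin X Z) : T =1 S -> T = S.
Proof. by move=> TS; apply/val_inj/funext. Qed.

Lemma blin_linear (X Z : normedModType R) (T : blin X Z) : linear T.
Proof. by case: T => T /= /asboolP[]. Qed.

HB.instance Definition _ (X Z : normedModType R) (T : blin X Z) :=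
  GRing.isLinear.Build R X Z *:%R (T : X -> Z) (blin_linear T).

Lemma blin_bounded (X Z : normedModType R) (T : blin X Z) :
  exists2 M : R, 0 <= M & forall x, `|T x| <= M * `|x|.
Proof.
case: T => T /= /asboolP[_ [M TM]]; exists `|M| => // x.
by rewrite (le_trans (TM x))// ler_wpM2r// ler_norm.
Qed.

Definition mkblin (X Z : normedModType R) (T : X -> Z) (linT : linear T)
    (bndT : exists M : R, forall x, `|T x| <= M * `|x|) : blin X Z :=
  Blin (introT (asboolP _) (conj linT bndT)).

Lemma bounded_linear_submod_closed (X Z : normedModType R) :
  submod_closed (@bounded_linear X Z).
Proof.
split=> [|a T S /asboolP[linT [M TM]] /asboolP[linS [N SN]]]; apply/asboolP.
  split=> [k x y|]; first by rewrite /= scaler0 addr0.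
  by exists 0 => x; rewrite normr0 mul0r.
split=> [k x y|].
  rewrite !fctE linT linS !scalerDr !scalerA (mulrC a k) -!addrA.
  by congr (_ + _); rewrite addrCA.
exists (`|a| * M + N) => x; rewrite !fctE (le_trans (ler_normD _ _))//.
by rewrite mulrDl lerD// normrZ -mulrA ler_wpM2l.
Qed.

HB.instance Definition _ (X Z : normedModType R) :=
  GRing.isSubmodClosed.Build R (X -> Z) (@bounded_linear X Z)
    (@bounded_linear_submod_closed X Z).

HB.instance Definition _ (X Z : normedModType R) :=
  [SubChoice_isSubLmodule of blin X Z by <:].

Section operator_norm.
Context {X Z : normedModType R}.
Implicit Types T S : blin X Z.

Definition opnorm T : R := sup [set `|T x| | x in [set x : X | `|x| <= 1]].

Lemma opnorm_has_sup T : has_sup [set `|T x| | x in [set x : X | `|x| <= 1]].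
Proof.
split; first by exists `|T 0|, 0 => //=; rewrite normr0.
have [M M0 TM] := blin_bounded T; exists M => _ [x /= x1 <-].
by rewrite (le_trans (TM x))// ler_piMr.
Qed.

Lemma opnorm_ge0 T : 0 <= opnorm T.
Proof.
rewrite (@le_trans _ _ `|T 0|)//; apply: (sup_upper_bound (opnorm_has_sup T)).
by exists 0 => //=; rewrite normr0.
Qed.

Lemma ler_opnorm T x : `|T x| <= opnorm T * `|x|.
Proof.
have [->|x0] := eqVneq x 0; first by rewrite linear0 !normr0 mulr0.
have nx : 0 < `|x| by rewrite normr_gt0.
rewrite -ler_pdivrMr//; apply: (sup_upper_bound (opnorm_has_sup T)).
exists (`|x|^-1 *: x) => /=.
  by rewrite normrZ normfV normr_id mulVf// gt_eqF.
by rewrite linearZ normrZ normfV normr_id mulrC.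
Qed.

Lemma opnorm_le T M : 0 <= M -> (forall x, `|T x| <= M * `|x|) -> opnorm T <= M.
Proof.
move=> M0 TM; apply: ge_sup; first by case: (opnorm_has_sup T).
by move=> _ [x /= x1 <-]; rewrite (le_trans (TM x))// ler_piMr.
Qed.

Lemma opnormD T S : opnorm (T + S) <= opnorm T + opnorm S.
Proof.
apply: opnorm_le => [|x]; first by rewrite addr_ge0// opnorm_ge0.
by rewrite (le_trans (ler_normD _ _))// mulrDl lerD// ler_opnorm.
Qed.

Lemma opnormZ a T : opnorm (a *: T) = `|a| * opnorm T.
Proof.
have le b S : opnorm (b *: S) <= `|b| * opnorm S.
  apply: opnorm_le => [|x]; first by rewrite mulr_ge0// opnorm_ge0.
  by rewrite /= normrZ -mulrA ler_wpM2l// ler_opnorm.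
apply/eqP; rewrite eq_le le/=; have [->|a0] := eqVneq a 0.
  by rewrite normr0 mul0r opnorm_ge0.
have := le a^-1 (a *: T); rewrite scalerA mulVf// scale1r normfV.
by rewrite ler_pdivlMl// normr_gt0.
Qed.

Lemma opnorm0_eq0 T : opnorm T = 0 -> T = 0.
Proof.
move=> T0; apply: blinP => x; apply/eqP; rewrite -normr_le0.
by rewrite (le_trans (ler_opnorm T x))// T0 mul0r.
Qed.

HB.instance Definition _ :=
  Lmodule_isNormed.Build R (blin X Z) opnormD opnormZ opnorm0_eq0.

End operator_norm.

Definition dual (X : normedModType R) := blin X R.

End bounded_linear_operators.

Section duality.
Context {R : realType}.

Section adjoint.
Context {X Z : normedModType R} (T : blin X Z) (f : dual Z).

Fact dual_map_linear : linear (fun x => f (T x)).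
Proof. by move=> a x y; rewrite !linearP. Qed.

Fact dual_map_bounded : exists M : R, forall x, `|f (T x)| <= M * `|x|.
Proof.
exists (`|f| * `|T|) => x; apply: le_trans (ler_opnorm f (T x)) _.
by rewrite -mulrA; apply: ler_wpM2l; [exact: opnorm_ge0|exact: ler_opnorm].
Qed.

Definition dual_map : dual X := mkblin dual_map_linear dual_map_bounded.

End adjoint.

Section bidual.
Context {X : normedModType R} (x : X).

Fact bidual_linear : linear (fun f : dual X => f x).
Proof. by []. Qed.

Fact bidual_bounded : exists M : R, forall f : dual X, `|f x| <= M * `|f|.
Proof. by exists `|x| => f; rewrite mulrC; exact: ler_opnorm. Qed.

Definition bidual : dual (dual X) := mkblin bidual_linear bidual_bounded.

End bidual.

(* [T^*] for [T : X -> Z'], with [Z''] identified with [Z]. *)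
Definition pre_dual_map (X Z : normedModType R) (T : blin X (dual Z)) (z : Z) :
  dual X := dual_map T (bidual z).

End duality.

Section bilinear_form_operator.
Context {R : realType} {Y V : normedModType R}.

Definition bounded_form (b : Y -> V -> R) :=
  exists M : R, forall y v, `|b y v| <= M * `|y| * `|v|.

Variables (b : {bilinear Y -> V -> R | *%R & *%R}) (bbnd : bounded_form b).

Fact form_op_linear1 (y : Y) : linear (b y).
Proof. by move=> a u v; rewrite linearDr linearZr_LR. Qed.

Fact form_op_bounded1 (y : Y) : exists M : R, forall v, `|b y v| <= M * `|v|.
Proof. by have [M bM] := bbnd; exists (M * `|y|) => v. Qed.

Fact form_op_linear :
  linear (fun y => mkblin (form_op_linear1 y) (form_op_bounded1 y) : dual V).
Proof. by move=> a x y; apply: blinP => v /=; rewrite linearDl linearZl_LR. Qed.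

Fact form_op_bounded : exists M : R, forall y,
  `|mkblin (form_op_linear1 y) (form_op_bounded1 y) : dual V| <= M * `|y|.
Proof.
have [M bM] := bbnd; exists `|M| => y; apply: opnorm_le => [|v].
  by rewrite mulr_ge0.
by rewrite (le_trans (bM y v))// ler_wpM2r// ler_wpM2r// ler_norm.
Qed.

Definition form_op : blin Y (dual V) := mkblin form_op_linear form_op_bounded.

End bilinear_form_operator.

Section riesz.
Context {R : realType} {X : hilbertType R}.

Fact riesz_linear (x : X) : linear (dotp x : X -> R).
Proof. by move=> a y z; rewrite dotpDr dotpZr. Qed.

Fact riesz_bounded (x : X) : exists M : R, forall y : X, `|dotp x y| <= M * `|y|.
Proof. by exists `|x| => y; exact: CauchySchwarz_dotp. Qed.

Definition riesz (x : X) : dual X := mkblin (riesz_linear x) (riesz_bounded x).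

Lemma riesz_inj : injective riesz.
Proof.
move=> x y xy; apply/eqP; rewrite -subr_eq0 -normr_eq0 -sqrf_eq0 -dotp_normE.
have := congr1 (fun f : dual X => f (x - y)) xy.
by rewrite /= dotpDl dotpNl => ->; rewrite subrr.
Qed.

Lemma riesz_surj (f : dual X) : exists x, riesz x = f.
Proof.
have fD u v : f (u + v) = f u + f v by rewrite linearD.
have fZ a u : f (a *: u) = a * f u by rewrite linearZ.
pose phi x := `|x| ^+ 2 - 2 * f x.
have phi_lb : has_inf (range phi).
  split; first by exists (phi 0), 0.
  exists (- `|f| ^+ 2) => _ [x _ <-]; rewrite /phi.
  have fx : f x <= `|f| * `|x|.
    exact: le_trans (ler_norm _) (ler_opnorm f x).
  have := sqr_ge0 (`|x| - `|f|); move: fx; nra.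
pose m := inf (range phi).
have m_le x : m <= phi x by apply: (ge_inf (proj2 phi_lb)); exists x.
pose A d := [set x | phi x < m + d].
have A_neq0 d : 0 < d -> exists x, A d x.
  by move=> d0; have [_ [x _ <-] ?] := inf_adherent d0 phi_lb; exists x.
have A_near d x y : A d x -> A d y -> `|x - y| ^+ 2 < 4 * d.
  rewrite /A /= => Ax Ay; have := m_le (2^-1 *: (x + y)).
  move: Ax Ay; rewrite /phi fZ fD normrZ.
  by rewrite ger0_norm ?invr_ge0// exprMn normDsq normBsq; lra.
pose F := filter_from [set d : R | 0 < d] A.
have FF : ProperFilter F.
  apply: filter_from_proper; last by move=> d d0; exact: A_neq0.
  apply: filter_from_filter; first by exists 1 => /=.
  move=> d e d0 e0; exists (Num.min d e); first by rewrite /= lt_min d0.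
  by move=> x; rewrite /A /= -ltrBlDl lt_min !ltrBlDl => /andP[].
have Fcauchy : cauchy F.
  apply: cauchy_exP => e e0; have e40 : 0 < e ^+ 2 / 4 by rewrite divr_gt0// exprn_gt0.
  have [x Ax] := A_neq0 _ e40; exists x; exists (e ^+ 2 / 4) => // y Ay.
  rewrite -ball_normE /=; have := A_near _ _ _ Ax Ay.
  have -> : 4 * (e ^+ 2 / 4) = e ^+ 2 by field.
  by rewrite ltr_pXn2r ?nnegrE// ltW.
have /cvg_ex[l Fl] : cvg F by exact: cauchy_cvg.
have critical d x y : A d x -> 0 <= d -> `|dotp x y - f y| ^+ 2 <= d * `|y| ^+ 2.
  rewrite /A /= => Ax d0; have [->|y0] := eqVneq y 0.
    by rewrite -[X in dotp _ X](scale0r 0) dotpZr mul0r linear0 subrr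
      !normr0 !expr0n/= mulr0.
  have ny : 0 < `|y| ^+ 2 by rewrite exprn_gt0// normr_gt0.
  rewrite -normrX ger0_norm ?sqr_ge0//.
  set c := dotp x y - f y; pose t := - (c / `|y| ^+ 2).
  have := m_le (x + t *: y); rewrite /phi normDsq fD fZ dotpZr.
  rewrite normrZ exprMn -normrX (ger0_norm (sqr_ge0 t)).
  have tn : t * `|y| ^+ 2 = - c by rewrite mulNr divfK// gt_eqF.
  have -> : t ^+ 2 * `|y| ^+ 2 = - (t * c) by rewrite expr2 -mulrA tn mulrN.
  have ce : f y = dotp x y - c by rewrite /c; lra.
  rewrite ce => h; have tc : - (t * c) < d by move: Ax; rewrite /phi; lra.
  have -> : c ^+ 2 = - (t * c) * `|y| ^+ 2 by rewrite mulNr mulrAC tn; lra.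
  by rewrite ler_pM2r// ltW.
exists l; apply: blinP => y /=; apply/eqP; rewrite -subr_eq0 -normr_le0.
apply/ler_addgt0Pr => e e0; rewrite add0r.
pose d := e / (2 * (1 + `|y|)).
have y1 : 0 < 1 + `|y| by rewrite ltr_pwDl.
have d0 : 0 < d by rewrite divr_gt0// mulr_gt0.
have Fd : F (A (d ^+ 2)) by exists (d ^+ 2) => //=; exact: exprn_gt0.
have Fb : F (ball l d) by apply: Fl; exact: nbhsx_ballx.
have [x [Ax]] := filter_ex (filterI Fd Fb); rewrite -ball_normE/= => lx.
have -> : dotp l y - f y = dotp (l - x) y + (dotp x y - f y).
  by rewrite dotpDl dotpNl; lra.
rewrite (le_trans (ler_normD _ _))//.
have cx : `|dotp x y - f y| <= d * `|y|.
  have dy : 0 <= d * `|y| by rewrite mulr_ge0// ltW.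
  rewrite -(@ler_pXn2r _ 2) ?nnegrE//.
  by rewrite exprMn; apply: critical => //; exact: sqr_ge0.
have cl : `|dotp (l - x) y| <= d * `|y|.
  by rewrite (le_trans (CauchySchwarz_dotp _ _))// ler_wpM2r// ltW.
have -> : e = 2 * d * (1 + `|y|) by rewrite /d; field; rewrite gt_eqF.
by move: cx cl; rewrite mulrDr mulr1; lra.
Qed.

Definition riesz_inv (f : dual X) : X := sval (cid (riesz_surj f)).

Lemma riesz_invK : cancel riesz_inv riesz.
Proof. by move=> f; rewrite /riesz_inv; case: cid. Qed.

Lemma rieszK : cancel riesz riesz_inv.
Proof. by move=> x; apply: riesz_inj; rewrite riesz_invK. Qed.

End riesz.

Section optimal_control.
Context {R : realType}.

Definition linear_subspace (X : lmodType R) (S : set X) := submod_closed (mem S).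

Definition findim_subspace (X : lmodType R) (S : set X) :=
  exists (n : nat) (e : 'I_n -> X),
    S = [set \sum_(i < n) a i *: e i | a in [set: 'I_n -> R]].

Context {U Y V Obs : hilbertType R}.
Variables (b : Y -> V -> R) (O : blin Y Obs) (D : blin U (dual V)).

(* [sup set0 = 0], so that [V = 0] is allowed and then forces [Y = 0]. *)
Definition inf_sup (Cb : R) :=
  forall y, Cb * `|y| <= sup [set b y v / `|v| | v in [set v | v != 0]].

Definition cost (yd : Obs) (alpha : R) (z : Y * U) : R :=
  2^-1 * `|O z.1 - yd| ^+ 2 + alpha / 2 * `|z.2| ^+ 2.

(* Trial space [Ys], control set [Us] and test space [Vs]: the continuous
   problem is [Ys := setT], [Vs := setT]. *)
Definition feasible (Ys : set Y) (Us : set U) (Vs : set V) : set (Y * U) :=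
  [set z | [/\ Ys z.1, Us z.2 & forall v, Vs v -> b z.1 v = D z.2 v]].

Definition minimizer (T : Type) (J : T -> R) (A : set T) (z : T) :=
  A z /\ forall z', A z' -> J z <= J z'.

(* [O^* I (O y - yd)] *)
Definition misfit (yd : Obs) (y : Y) : dual Y := dual_map O (riesz (O y - yd)).

Definition adjoint_state (Ys : set Y) (Vs : set V) (yd : Obs) (y : Y)
    (lam : Y) (p : V) :=
  [/\ Ys lam, Vs p,
      forall v, Vs v -> dotp p v - b lam v = 0 &
      forall w, Ys w -> b w p = misfit yd y w].

Definition trial_to_test (Vh : set V) (Theta : Y -> V) :=
  forall y, Vh (Theta y) /\ forall v, Vh v -> dotp (Theta y) v = b y v.

(* Linearity of [Pi] is not required. *)
Definition fortin (Yh : set Y) (Vh : set V) (Pi : V -> V) :=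
  [/\ forall v, Vh (Pi v),
      exists2 CPi : R, 0 < CPi & forall v, `|Pi v| <= CPi * `|v| &
      forall y v, Yh y -> b y (v - Pi v) = 0].

End optimal_control.

(* Main.v *)
(** Everything rests on [B] being an isomorphism: surjectivity of [B] follows
    from Zarantonello's theorem applied to the strongly monotone map
    [B^* I B : Y -> Y'], and it turns the inf-sup bound for [B] into the same
    bound for [B^*].  This gives the state and adjoint estimates.  For the
    control, test the two variational inequalities against each other and
    rewrite the result with the state [yt] such that [B yt = D ut]; writing
    [res] for the adjoint residual [O^* I (O yh - yd) - B^* ph],
    [[
      alpha |u - ut|^2 + |O (yt - y)|^2
        <= (O (yt - yh), O (yt - y)) + <res, yt - y>
    ]]
    where [yt - y] is controlled by [u - ut].  Bounding both terms on the right
    by a multiple of [|u - ut|] and dividing by it gives an estimate of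
    [alpha |u - ut|] whose constant does not depend on [alpha]. *)

Require Import Defs.
From HB Require Import structures.
From mathcomp Require Import all_boot all_order all_algebra.
From mathcomp Require Import all_classical all_reals.
From mathcomp Require Import topology normedtype convex.
From mathcomp Require Import interval_inference sequences ring lra.

Set Implicit Arguments.
Unset Strict Implicit.
Unset Printing Implicit Defensive.

Import Order.TTheory GRing.Theory Num.Theory.
Import numFieldNormedType.Exports.

Local Open Scope classical_set_scope.
Local Open Scope ring_scope.

(** * Riesz representatives and strongly monotone maps *)

Section hilbert_surjectivity.
Context {R : realType} {X : hilbertType R}.

Lemma dotp_riesz_inv (f : dual X) x : dotp (riesz_inv f) x = f x.
Proof. by rewrite -[f in RHS]riesz_invK. Qed.

Lemma riesz_invB (f g : dual X) :
  riesz_inv (f - g) = riesz_inv f - riesz_inv g.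
Proof.
apply: riesz_inj; rewrite riesz_invK; apply: blinP => x /=.
by rewrite dotpDl dotpNl !dotp_riesz_inv.
Qed.

Lemma norm_riesz_inv (f : dual X) : `|riesz_inv f| = `|f|.
Proof.
apply/eqP; rewrite eq_le; apply/andP; split.
  have [->|f0] := eqVneq (riesz_inv f) 0; first by rewrite normr0 normr_ge0.
  have n0 : 0 < `|riesz_inv f| by rewrite normr_gt0.
  rewrite -(ler_pM2r n0) -expr2 -dotp_normE dotp_riesz_inv.
  exact: le_trans (ler_norm _) (ler_opnorm f _).
apply: opnorm_le => // x; rewrite -dotp_riesz_inv.
exact: CauchySchwarz_dotp.
Qed.

(* Zarantonello: [x - t (f x - x0)] is a contraction for small [t > 0]. *)
Lemma strongly_monotone_surj (f : X -> X) (c M : R) : 0 < c ->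
  (forall x y, c * `|x - y| ^+ 2 <= dotp (f x - f y) (x - y)) ->
  (forall x y, `|f x - f y| <= M * `|x - y|) ->
  forall x0, exists x, f x = x0.
Proof.
move=> c0 fc fM x0.
(* Taking the maximum makes the Lipschitz constant positive and gives [c <= L], hence [0 <= k]
   below. *)
pose L := Num.max M c; have L0 : 0 < L by rewrite lt_max c0 orbT.
have fL x y : `|f x - f y| <= L * `|x - y|.
  by rewrite (le_trans (fM x y))// ler_wpM2r// le_max lexx.
have cL : c <= L by rewrite le_max lexx orbT.
(* This [t] minimises [1 - 2 t c + t ^ 2 L ^ 2], the bound on the squared contraction factor; the
   minimum is [k]. *)
pose t := c / L ^+ 2; have t0 : 0 < t by rewrite divr_gt0// exprn_gt0.
have tL : t * L ^+ 2 = c by rewrite divfK// gt_eqF// exprn_gt0.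
pose k := 1 - t * c.
have k1 : k < 1 by rewrite /k gtrBl mulr_gt0.
have k0 : 0 <= k.
  rewrite /k subr_ge0 /t mulrAC -expr2 ler_pdivrMr ?exprn_gt0// mul1r.
  by rewrite ler_pXn2r ?nnegrE// ltW.
pose g x := x - t *: (f x - x0).
have gk x y : `|g x - g y| <= Num.sqrt k * `|x - y|.
  have -> : g x - g y = (x - y) - t *: (f x - f y).
    by rewrite /g opprD addrACA -opprD -scalerBr opprB addrA subrK.
  rewrite -(@ler_pXn2r _ 2) ?nnegrE ?mulr_ge0 ?sqrtr_ge0//.
  rewrite exprMn sqr_sqrtr// normBsq dotpZr normrZ (gtr0_norm t0) exprMn.
  have := fc x y; rewrite dotpC => h1.
  have h2 : `|f x - f y| ^+ 2 <= L ^+ 2 * `|x - y| ^+ 2.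
    by rewrite -exprMn ler_pXn2r ?nnegrE// mulr_ge0// ltW.
  have h3 : t ^+ 2 * `|f x - f y| ^+ 2 <= t * c * `|x - y| ^+ 2.
    have : t ^+ 2 * `|f x - f y| ^+ 2 <= t ^+ 2 * (L ^+ 2 * `|x - y| ^+ 2).
      by rewrite ler_pM2l// exprn_gt0.
    by rewrite -tL; lra.
  have h4 : t * (c * `|x - y| ^+ 2) <= t * dotp (x - y) (f x - f y).
    by rewrite ler_pM2l.
  by rewrite /k; lra.
have gctr : is_contraction [fun of totalfun g].
  exists ((Num.sqrt k)%:nng); split => [|[x y] _] /=; last exact: gk.
  by rewrite -sqrtr1 ltr_sqrt.
have [|x _ xg] := banach_fixed_point gctr closedT; first by exists 0.
exists x; apply/eqP; rewrite -subr_eq0; move/eqP: xg.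
by rewrite -subr_eq0 /= subKr scaler_eq0 gt_eqF.
Qed.

End hilbert_surjectivity.

(** * Bijectivity and lower bounds for the operator of the form *)

Section inf_sup_operator.
Context {R : realType} {Y V : hilbertType R}.
Context (b : {bilinear Y -> V -> R | *%R & *%R}) (bbnd : bounded_form b).
Context (Cb : R) (Cb0 : 0 < Cb) (b_infsup : inf_sup b Cb).
Context (b_nondeg : [set v | forall y, b y v = 0] = [set 0]).

Local Notation B := (form_op bbnd : blin Y (dual V)).

Lemma form_op_lower y : Cb * `|y| <= `|B y|.
Proof.
apply: le_trans (b_infsup y) _.
(* The set is empty when [V] is trivial; its supremum is then 0 by convention. *)
have [->|/set0P A0] :=
    eqVneq [set b y v / `|v| | v in [set v : V | v != 0]] set0.
  by rewrite sup0.
apply: ge_sup => // _ [v /= v0 <-].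
rewrite ler_pdivrMr ?normr_gt0//.
exact: le_trans (ler_norm _) (ler_opnorm (B y : dual V) v).
Qed.

Lemma form_op_surj (f : dual V) : exists y, B y = f.
Proof.
pose r y := riesz_inv (B y : dual V).
have rB x y : r x - r y = r (x - y) by rewrite /r linearB riesz_invB.
have rE y v : dotp (r y) v = b y v by rewrite dotp_riesz_inv.
have rM y : `|r y| <= `|B| * `|y| by rewrite norm_riesz_inv ler_opnorm.
(* [s] represents [B^* I B] on [Y]: pairing [s x - s y] with [x - y] gives the square of the norm of
   [r (x - y)], so the lower bound on [B] yields the monotonicity constant [Cb ^ 2]. *)
pose s y : Y := riesz_inv (pre_dual_map B (r y)).
have sE y w : dotp (s y) w = b w (r y) by rewrite dotp_riesz_inv.
have sBE x y w : dotp (s x - s y) w = dotp (r (x - y)) (r w).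
  by rewrite dotpDl dotpNl !sE -!rE -dotpNr -dotpDr rB dotpC.
have [|x y|x y|y sy] := @strongly_monotone_surj _ _ s (Cb ^+ 2) (`|B| ^+ 2) _
    _ _ (riesz_inv (pre_dual_map B (riesz_inv f))).
- by rewrite exprn_gt0.
- rewrite sBE dotp_normE -exprMn ler_pXn2r ?nnegrE ?mulr_ge0 ?(ltW Cb0)//.
  by rewrite norm_riesz_inv form_op_lower.
- have [->|d0] := eqVneq (s x - s y) 0; first by rewrite normr0 mulr_ge0.
  rewrite -(@ler_pM2r _ `|s x - s y|) ?normr_gt0// -expr2 -dotp_normE sBE.
  apply: le_trans (dotp_ler _ _) _.
  by rewrite (le_trans (ler_pM _ _ (rM _) (rM _)))// expr2; lra.
exists y; rewrite -[f]riesz_invK -[LHS]riesz_invK; congr riesz.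
apply/eqP; rewrite -subr_eq0; apply/eqP.
(* Solving [s y = x0] only gives equality after applying [B^*]; nondegeneracy says that [B^*] is
   injective. *)
suff : [set v | forall y, b y v = 0] (r y - riesz_inv f) by rewrite b_nondeg.
move=> w; rewrite linearBr; apply/eqP; rewrite subr_eq0; apply/eqP.
by have := sE y w; rewrite sy dotp_riesz_inv.
Qed.

(** Choose [y] with [B y = riesz v]. Then the square of the norm of [v] is [b y v], at most the norm
    of [B^* v] times that of [y], and the lower bound on [B] controls [y] by [v]. *)
Lemma form_op_dual_lower v : Cb * `|v| <= `|pre_dual_map B v|.
Proof.
have [->|v0] := eqVneq v 0; first by rewrite normr0 mulr0.
have [y yv] := form_op_surj (riesz v).
have yE w : b y w = dotp v w.
  exact: (congr1 (fun f : dual V => f w) yv).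
have nv : 0 < `|v| by rewrite normr_gt0.
have vy : `|v| ^+ 2 <= `|pre_dual_map B v| * `|y|.
  rewrite -dotp_normE -yE.
  exact: le_trans (ler_norm _) (ler_opnorm (pre_dual_map B v) y).
have yv' : Cb * `|y| <= `|v|.
  rewrite (le_trans (form_op_lower y))// yv -norm_riesz_inv.
  by rewrite rieszK.
rewrite -(ler_pM2r nv) -mulrA -expr2.
have := ler_wpM2l (normr_ge0 (pre_dual_map B v)) yv'.
by have := ler_wpM2l (ltW Cb0) vy; lra.
Qed.

End inf_sup_operator.

(** * First-order optimality for the continuous problem *)

Section optimality.
Context {R : realType} {U Y V Obs : hilbertType R}.
Context (b : {bilinear Y -> V -> R | *%R & *%R}).
Context (O : blin Y Obs) (D : blin U (dual V)).

Lemma misfitB (yd : Obs) (x y w : Y) :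
  misfit O yd x w - misfit O yd y w = dotp (O (x - y)) (O w).
Proof.
rewrite [O (x - y)]linearB /= -dotpNl -dotpDl.
by rewrite opprB addrA subrK.
Qed.

Lemma cost_directional (yd : Obs) (alpha t : R) (y z : Y) (u w : U) :
  cost O yd alpha (y + t *: z, u + t *: w) =
  cost O yd alpha (y, u) + t * (misfit O yd y z + alpha * dotp u w)
    + t ^+ 2 * (2^-1 * `|O z| ^+ 2 + alpha / 2 * `|w| ^+ 2).
Proof.
rewrite /cost /= linearD linearZ addrAC !normDsq !dotpZr !normrZ !exprMn.
rewrite -!normrX (ger0_norm (sqr_ge0 t)); by field.
Qed.

Lemma ge0_of_quadratic (p q : R) :
  (forall t : R, 0 < t -> t <= 1 -> 0 <= t * p + t ^+ 2 * q) -> 0 <= p.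
Proof.
move=> pq; rewrite leNgt; apply/negP => p0.
have q1 : 0 < 1 + `|q| by rewrite ltr_pwDl.
(* Small enough that the quadratic term absorbs at most half of [- p], so that [p + t q] stays
   negative. *)
pose t := Num.min 1 (- p / (2 * (1 + `|q|))).
have t0 : 0 < t by rewrite lt_min ltr01 divr_gt0// ?oppr_gt0// mulr_gt0.
have t1 : t <= 1 by rewrite ge_min lexx.
have tp : t * (2 * (1 + `|q|)) <= - p.
  by rewrite -ler_pdivlMr ?mulr_gt0// ge_min lexx orbT.
have := pq t t0 t1; rewrite expr2 -mulrA -mulrDr pmulr_rge0// => h.
have : t * q <= t * `|q| by rewrite ler_pM2l// ler_norm.
lra.
Qed.

(** Surjectivity of [B] gives the state variation [z] matching the control variation [u' - u], so
    the segment from [u] towards [u'] stays feasible. The derivative of the cost along it is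
    nonnegative, and the adjoint equation eliminates [z] from it. *)
Lemma optimality_condition (bbnd : bounded_form b) (Cb : R) (Cb0 : 0 < Cb) :
  inf_sup b Cb -> [set v | forall y, b y v = 0] = [set 0] ->
  forall (Uad : set U) (yd : Obs) (alpha : R) (y : Y) (u : U) (lam : Y) (p : V),
  convex_set Uad ->
  minimizer (cost O yd alpha) (feasible b D setT Uad setT) (y, u) ->
  adjoint_state b O setT setT yd y lam p ->
  forall u', Uad u' -> 0 <= D (u' - u) p + alpha * dotp u (u' - u).
Proof.
move=> b_infsup b_nondeg Uad yd alpha y u lam p cvx [[/= _ Uadu yu] ymin].
move=> [_ _ _ adj] u' Uadu'.
have [z zu] := form_op_surj bbnd Cb0 b_infsup b_nondeg (D (u' - u)).
have zE v : b z v = D (u' - u) v.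
  exact: (congr1 (fun f : dual V => f v) zu).
rewrite -zE adj//; pose q := 2^-1 * `|O z| ^+ 2 + alpha / 2 * `|u' - u| ^+ 2.
apply: (@ge0_of_quadratic _ q) => t t0 t1.
have : feasible b D setT Uad setT (y + t *: z, u + t *: (u' - u)).
  split=> //=; last first.
    move=> v _; rewrite linearDl linearZl_LR zE yu//.
    by rewrite [D (u + _)](linearD D) (linearZ_LR D).
  have := cvx u' u (Itv01 (ltW t0) t1); rewrite !inE => /(_ Uadu' Uadu).
  rewrite /conv/= /unstable.onem scalerBl scale1r scalerBr.
  by rewrite addrCA.
by move=> /ymin; rewrite cost_directional -addrA lerDl.
Qed.

End optimality.

(** * The error estimates *)

Lemma sum3_sqr_le (R : realType) (L A a1 a2 a3 : R) :
  0 <= L -> 0 <= A -> 0 <= a1 -> 0 <= a2 -> 0 <= a3 ->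
  A <= L * (a1 + a2 + a3) ->
  A ^+ 2 <= 3 * L ^+ 2 * (a1 ^+ 2 + a2 ^+ 2 + a3 ^+ 2).
Proof.
move=> L0 A0 a10 a20 a30 AL.
have AL2 : A ^+ 2 <= L ^+ 2 * (a1 + a2 + a3) ^+ 2.
  by rewrite -exprMn ler_pXn2r ?nnegrE// mulr_ge0// !addr_ge0.
apply: (le_trans AL2).
have : (a1 + a2 + a3) ^+ 2 <= 3 * (a1 ^+ 2 + a2 ^+ 2 + a3 ^+ 2).
  have := sqr_ge0 (a1 - a2); have := sqr_ge0 (a1 - a3).
  by have := sqr_ge0 (a2 - a3); lra.
by move=> /(ler_wpM2l (sqr_ge0 L)); lra.
Qed.

Theorem theorem4p8 (R : realType) (U Y V Obs : hilbertType R)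
    (b : {bilinear Y -> V -> R | *%R & *%R}) (b_bounded : bounded_form b)
    (O : blin Y Obs) (D : blin U (dual V)) :
  (exists2 Cb : R, 0 < Cb & inf_sup b Cb) ->
  [set v | forall y, b y v = 0] = [set 0] ->
  let B : blin Y (dual V) := form_op b_bounded in
  exists2 C : R, 0 < C &
  forall (Uad : set U) (yd : Obs) (alpha : R),
    Uad !=set0 -> bounded_set Uad -> closed Uad -> convex_set Uad ->
    0 < alpha ->
  forall (Vh : set V) (Yh : set Y) (Uh : set U),
    findim_subspace Vh -> findim_subspace Yh -> linear_subspace Uh ->
    Uh `&` Uad !=set0 ->
  forall Theta : Y -> V, trial_to_test b Vh Theta ->
  forall Pi : V -> V, fortin b Yh Vh Pi ->
  forall (y : Y) (u : U) (yh : Y) (uh : U),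
    minimizer (cost O yd alpha) (feasible b D setT Uad setT) (y, u) ->
    minimizer (cost O yd alpha)
      (feasible b D Yh (Uh `&` Uad) (Theta @` Yh)) (yh, uh) ->
  forall (lam : Y) (p : V) (lamh : Y) (ph : V),
    adjoint_state b O setT setT yd y lam p ->
    adjoint_state b O Yh Vh yd yh lamh ph ->
  forall ut : U, Uad ut ->
    (forall u' : U, Uad u' ->
      0 <= dotp (riesz_inv (pre_dual_map D ph) + alpha *: ut) (u' - ut)) ->
  [/\ alpha ^+ 2 * `|u - uh| ^+ 2 <=
        C * ((1 + alpha ^+ 2) * `|ut - uh| ^+ 2 + `|D uh - B yh| ^+ 2
             + `|misfit O yd yh - pre_dual_map B ph| ^+ 2),
      `|y - yh| ^+ 2 <= C * (`|D uh - B yh| ^+ 2 + `|u - uh| ^+ 2) &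
      `|p - ph| ^+ 2 <=
        C * (`|D uh - B yh| ^+ 2
             + `|misfit O yd yh - pre_dual_map B ph| ^+ 2 + `|u - uh| ^+ 2)].
Proof.
move=> [Cb Cb0 b_infsup] b_nondeg B.
pose k := opnorm D; pose n := opnorm O ^+ 2.
have k0 : 0 <= k by exact: opnorm_ge0.
have n0 : 0 <= n by exact: sqr_ge0.
pose c := Cb^-1; have c0 : 0 < c by rewrite invr_gt0.
(* The summands are the coefficients that occur in the three unsquared estimates, so [L] dominates
   each of them; none depends on [alpha] or on the discretization. *)
pose L := 1 + c + k * c + n * c * c + n * c * c * k + n * c * c * k * k.
have cge0 := ltW c0.
have kc0 : 0 <= k * c by exact: mulr_ge0.
have nc0 : 0 <= n * c * c by exact: mulr_ge0 (mulr_ge0 n0 cge0) cge0.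
have nck0 : 0 <= n * c * c * k by exact: mulr_ge0.
have nckk0 : 0 <= n * c * c * k * k by exact: mulr_ge0.
have L1 : 1 <= L by rewrite /L; lra.
have Lc : c <= L by rewrite /L; lra.
have Lkc : k * c <= L by rewrite /L; lra.
have Lnc : n * c * c <= L by rewrite /L; lra.
have Lnck : n * c * c * k <= L by rewrite /L; lra.
have Lnckk : n * c * c * k * k <= L by rewrite /L; lra.
have L0 : 0 <= L by lra.
(* The factor 3 comes from squaring a sum of three terms, the further 2 from
   [(1 + alpha) ^ 2 <= 2 (1 + alpha ^ 2)]. *)
exists (6 * L ^+ 2).
  by rewrite mulr_gt0// exprn_gt0// (lt_le_trans ltr01).
move=> Uad yd alpha _ _ _ cvx alpha0 Vh Yh Uh _ _ _ _ Theta _ Pi _.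
move=> y u yh uh ymin _ lam p lamh ph padj _ ut Uadut utVI.
have uVI := optimality_condition b_bounded Cb0 b_infsup b_nondeg cvx ymin padj.
have [[/= _ Uadu yu] _] := ymin.
have pE w : b w p = misfit O yd y w by have [_ _ _ ->] := padj.
set E := `|D uh - B yh|; set S := `|misfit O yd yh - pre_dual_map B ph|.
have E0 : 0 <= E by exact: normr_ge0.
have S0 : 0 <= S by exact: normr_ge0.
(* Stated for any control, since it serves both for [(y, u)] and for the auxiliary pair
   [(yt, ut)]. *)
have state_le (z : Y) (w : U) : B z = D w ->
    `|z - yh| <= c * (k * `|w - uh| + E).
  move=> zw; rewrite /c ler_pdivlMl//.
  apply: le_trans (form_op_lower b_bounded b_infsup _) _.
  have -> : B (z - yh) = D (w - uh) + (D uh - B yh).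
    by rewrite (linearB B) (linearB D) addrA subrK; congr (_ - _).
  by rewrite (le_trans (ler_normD _ _))// lerD2r ler_opnorm.
have yB : B y = D u by apply: blinP => v; exact: yu.
have mis_le (z1 z2 w : Y) :
    misfit O yd z1 w - misfit O yd z2 w <= n * `|z1 - z2| * `|w|.
  rewrite misfitB (le_trans (dotp_ler _ _))//.
  rewrite (le_trans (ler_pM _ _ (ler_opnorm O _) (ler_opnorm O _)))//.
  by rewrite /n; lra.
have res_le (w : Y) : misfit O yd yh w - b w ph <= S * `|w|.
  apply: le_trans (ler_norm _) _.
  exact: (ler_opnorm (misfit O yd yh - pre_dual_map B ph) w).
have p_le : `|p - ph| <= c * (n * `|y - yh| + S).
  rewrite /c ler_pdivlMl//.
  apply: le_trans (form_op_dual_lower b_bounded Cb0 b_infsup b_nondeg _) _.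
  apply: opnorm_le => [|w].
    exact: addr_ge0 (mulr_ge0 n0 (normr_ge0 _)) S0.
  have half (w' : Y) : b w' (p - ph) <= (n * `|y - yh| + S) * `|w'|.
    rewrite linearBr pE mulrDl.
    by have := mis_le y yh w'; have := res_le w'; lra.
  rewrite ler_norml; apply/andP; split; last exact: half.
  by have := half (- w); rewrite linearNl normrN /=; lra.
set d := `|u - uh|; set a := `|ut - uh|.
have d0 : 0 <= d by exact: normr_ge0.
have a0 : 0 <= a by exact: normr_ge0.
have y_le := state_le _ _ yB.
have [yt ytB] := form_op_surj b_bounded Cb0 b_infsup b_nondeg (D ut).
have yt_le := state_le _ _ ytB.
have u_le : alpha * `|u - ut| <= k * c * (n * `|yt - yh| + S).
  have [ut0|ut0] := eqVneq (u - ut) 0.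
    rewrite ut0 normr0 mulr0; apply: mulr_ge0; first exact: mulr_ge0.
    exact: addr_ge0 (mulr_ge0 n0 (normr_ge0 _)) S0.
  have nut : 0 < `|u - ut| by rewrite normr_gt0.
  have w_le : `|yt - y| <= k * c * `|u - ut|.
    rewrite (mulrC k) -mulrA /c ler_pdivlMl//.
    apply: le_trans (form_op_lower b_bounded b_infsup _) _.
    have -> : B (yt - y) = D (ut - u).
      by rewrite (linearB B) (linearB D); congr (_ - _).
    by rewrite (le_trans (ler_opnorm _ _))// distrC.
  have bw v : b (yt - y) v = D (ut - u) v.
    rewrite linearBl yu// [D (ut - u)](linearB D).
    by rewrite -[b yt v]/((B yt : dual V) v) ytB.
  have h1 := uVI _ Uadut.
  have h2 := utVI _ Uadu.
  rewrite dotpDl dotp_riesz_inv dotpZl in h2.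
  have Dopp : pre_dual_map D ph (u - ut) = - D (ut - u) ph.
    by rewrite -[u - ut]opprB (linearN (pre_dual_map D ph)).
  rewrite Dopp -bw in h2; rewrite -bw pE in h1.
  (* Sum of the two variational inequalities, each tested with the other control. *)
  have key : alpha * `|u - ut| ^+ 2 <=
      misfit O yd y (yt - y) - b (yt - y) ph.
    move: h1 h2; rewrite -dotp_normE -[ut - u]opprB dotpNr.
    by rewrite [dotp (u - ut) _]dotpDl dotpNl; lra.
  (* Monotonicity of the misfit lets [yt] replace [y], and the distance from [yt] to [yh] is bounded
     without the unknown [u]. *)
  have neg : misfit O yd y (yt - y) - misfit O yd yt (yt - y) <= 0.
    rewrite misfitB -[y - yt]opprB (linearN O) dotpNl dotp_normE.
    by rewrite oppr_le0 sqr_ge0.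
  have h3 := mis_le yt yh (yt - y).
  have h4 := res_le (yt - y).
  rewrite -(ler_pM2r nut) -[leLHS]mulrA -expr2 (le_trans key)//.
  have nS0 : 0 <= n * `|yt - yh| + S.
    exact: addr_ge0 (mulr_ge0 n0 (normr_ge0 _)) S0.
  by have := ler_wpM2l nS0 w_le; lra.
have a1 : 0 <= (1 + alpha) * a by rewrite mulr_ge0// addr_ge0// ltW.
have control : alpha * d <= L * ((1 + alpha) * a + E + S).
  have tri : d <= `|u - ut| + a by rewrite /d -(subrKA ut) ler_normD.
  have h1 : alpha * d <= alpha * `|u - ut| + alpha * a.
    by rewrite -mulrDr ler_pM2l.
  have h2 := ler_wpM2l n0 yt_le.
  have h3 := ler_wpM2l kc0 h2.
  have h4 := ler_wpM2r a0 Lnckk; have h5 := ler_wpM2r E0 Lnck.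
  have h6 := ler_wpM2r S0 Lkc.
  have h7 : alpha * a <= L * (alpha * a) by rewrite ler_peMl// mulr_ge0// ltW.
  by move: h3; rewrite -/a; lra.
(* The zero fills the third slot of [sum3_sqr_le]. *)
have state : `|y - yh| <= L * (E + 0 + d).
  have h1 := ler_wpM2r d0 Lkc; have h2 := ler_wpM2r E0 Lc.
  by move: y_le; rewrite -/d; lra.
have adjoint : `|p - ph| <= L * (E + S + d).
  have h1 := ler_wpM2l cge0 (ler_wpM2l n0 y_le).
  have h2 := ler_wpM2r d0 Lnck; have h3 := ler_wpM2r E0 Lnc.
  have h4 := ler_wpM2r S0 Lc.
  by move: h1; rewrite -/d; lra.
have LL : 0 <= 3 * L ^+ 2 by rewrite mulr_ge0// sqr_ge0.
have ad0 : 0 <= alpha * d by rewrite mulr_ge0// ltW.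
have E2 := sqr_ge0 E; have S2 := sqr_ge0 S; have d2 := sqr_ge0 d.
split.
- have h1 := sum3_sqr_le L0 ad0 a1 E0 S0 control.
  have h2 : ((1 + alpha) * a) ^+ 2 + E ^+ 2 + S ^+ 2 <=
      2 * ((1 + alpha ^+ 2) * a ^+ 2 + E ^+ 2 + S ^+ 2).
    by have := sqr_ge0 ((1 - alpha) * a); lra.
  by have := ler_wpM2l LL h2; move: h1; rewrite exprMn; lra.
- have h1 := sum3_sqr_le L0 (normr_ge0 _) E0 (lexx 0) d0 state.
  have := ler_wpM2l LL (addr_ge0 E2 d2).
  by move: h1; rewrite expr0n /=; lra.
- have h1 := sum3_sqr_le L0 (normr_ge0 _) E0 S0 d0 adjoint.
  by have := ler_wpM2l LL (addr_ge0 (addr_ge0 E2 S2) d2); lra.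
Qed.
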